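(* Let $E$ be a finite graph and $K$ any field. Then the following are equivalent: (1) $C_K(E)$ has cancellation of projectives; (2) $C_K(E)$ is Hermite; (3) $C_K(E)$ is stably finite; (4) $C_K(E)$ is directly finite; (5) $E$ is acyclic.
   Context: A (directed) graph $E=(E^0,E^1,s,r)$ consists of disjoint sets $E^0$ (vertices) and $E^1$ (edges) and maps $s,r:E^1\to E^0$ (source and range); it is finite if $E^0$ and $E^1$ are finite. Graphs are assumed to have at least one vertex. For a field $K$, the Cohn path algebra $C_K(E)$ is the $K$-algebra generated by the set $\{v,e,e^*\mid v\in E^0,e\in E^1\}$ subject to, for all $v,w\in E^0$, $e,f\in E^1$: (1) $vw=\delta_{v,w}w$; (2) $s(e)e=e=er(e)$ and $r(e)e^*=e^*=e^*s(e)$; (3) $e^*f=\delta_{e,f}r(e)$. For finite $E$ it is unital with identity $\sum_{v\in E^0}v$. A closed path is a sequence of edges $e_1\cdots e_n$ ($n\ge 1$) with $r(e_i)=s(e_{i+1})$ for $1\le i<n$ and $r(e_n)=s(e_1)$; if $s(e_1),\dots,s(e_n)$ are distinct it determines a cycle (the subgraph with vertices $s(e_1),\dots,s(e_n)$ and edges $e_1,\dots,e_n$). $E$ is acyclic if it has no cycles. Let $R$ be a (nonzero, associative, unital) ring. $R$ is directly finite if for $a,b\in R$, $ab=1$ implies $ba=1$. $R$ is stably finite if for every positive integer $n$ and right $R$-module $Q$, $R^n\cong R^n\oplus Q$ (as right $R$-modules) implies $Q=0$. $R$ is Hermite if for all positive integers $m,n$ and any right $R$-module $Q$, $R^n\cong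 R^m\oplus Q$ implies $n\ge m$ and $Q\cong R^{n-m}$. $R$ has cancellation of projectives if for any finitely generated projective right $R$-modules $P,P'$, $P\oplus R\cong P'\oplus R$ implies $P\cong P'$. *)

(* Defs.v *)
From HB Require Import structures.
From mathcomp Require Import all_boot all_algebra.
From mathcomp Require Import boolp.

Set Implicit Arguments.
Unset Strict Implicit.
Unset Printing Implicit Defensive.

Import GRing.Theory.
Local Open Scope ring_scope.
Local Open Scope quotient_scope.

Record finGraph := FinGraph {
  vertex : finType;
  edge : finType;
  source : edge -> vertex;
  range : edge -> vertex;
  vertex_nonempty : (0 < #|vertex|)%N
}.

Definition closed_path (E : finGraph) (p : seq (edge E)) : bool :=
  (p != [::]) && cycle (fun e f => range e == source f) p.

Definition graph_cycle (E : finGraph) (p : seq (edge E)) : bool :=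
  closed_path p && uniq (map (@source E) p).

Definition acyclic (E : finGraph) : Prop :=
  ~ exists p : seq (edge E), graph_cycle p.

(* The Cohn path algebra, presented by generators and relations: formal
   non-unital K-algebra expressions in the generators, modulo the least
   congruence containing the K-algebra axioms and the relations.  The unit is
   not part of the presentation; it is the sum of the vertices. *)

Inductive cohn_term (E : finGraph) (K : fieldType) : Type :=
| TVertex of vertex E
| TEdge of edge E
| TGhost of edge E
| TZero
| TAdd of cohn_term E K & cohn_term E K
| TOpp of cohn_term E K
| TScale of K & cohn_term E K
| TMul of cohn_term E K & cohn_term E K.

Arguments TVertex {E K}.
Arguments TEdge {E K}.
Arguments TGhost {E K}.
Arguments TZero {E K}.

Inductive cohn_eq (E : finGraph) (K : fieldType) :
    cohn_term E K -> cohn_term E K -> Prop :=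
| ceq_refl x : cohn_eq x x
| ceq_sym x y : cohn_eq x y -> cohn_eq y x
| ceq_trans x y z : cohn_eq x y -> cohn_eq y z -> cohn_eq x z
| ceq_add x x' y y' :
    cohn_eq x x' -> cohn_eq y y' -> cohn_eq (TAdd x y) (TAdd x' y')
| ceq_opp x x' : cohn_eq x x' -> cohn_eq (TOpp x) (TOpp x')
| ceq_scale a x x' : cohn_eq x x' -> cohn_eq (TScale a x) (TScale a x')
| ceq_mul x x' y y' :
    cohn_eq x x' -> cohn_eq y y' -> cohn_eq (TMul x y) (TMul x' y')
| ceq_addA x y z : cohn_eq (TAdd x (TAdd y z)) (TAdd (TAdd x y) z)
| ceq_addC x y : cohn_eq (TAdd x y) (TAdd y x)
| ceq_add0 x : cohn_eq (TAdd TZero x) x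
| ceq_addN x : cohn_eq (TAdd (TOpp x) x) TZero
| ceq_scaleA a b x : cohn_eq (TScale a (TScale b x)) (TScale (a * b) x)
| ceq_scale1 x : cohn_eq (TScale 1 x) x
| ceq_scaleDr a x y :
    cohn_eq (TScale a (TAdd x y)) (TAdd (TScale a x) (TScale a y))
| ceq_scaleDl a b x :
    cohn_eq (TScale (a + b) x) (TAdd (TScale a x) (TScale b x))
| ceq_mulA x y z : cohn_eq (TMul x (TMul y z)) (TMul (TMul x y) z)
| ceq_mulDl x y z : cohn_eq (TMul (TAdd x y) z) (TAdd (TMul x z) (TMul y z))
| ceq_mulDr x y z : cohn_eq (TMul x (TAdd y z)) (TAdd (TMul x y) (TMul x z))
| ceq_scaleAl a x y : cohn_eq (TScale a (TMul x y)) (TMul (TScale a x) y)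
| ceq_scaleAr a x y : cohn_eq (TScale a (TMul x y)) (TMul x (TScale a y))
| ceq_vertex v w :
    cohn_eq (TMul (TVertex v) (TVertex w)) (if v == w then TVertex w else TZero)
| ceq_source_edge e : cohn_eq (TMul (TVertex (source e)) (TEdge e)) (TEdge e)
| ceq_edge_range e : cohn_eq (TMul (TEdge e) (TVertex (range e))) (TEdge e)
| ceq_range_ghost e : cohn_eq (TMul (TVertex (range e)) (TGhost e)) (TGhost e)
| ceq_ghost_source e : cohn_eq (TMul (TGhost e) (TVertex (source e))) (TGhost e)
| ceq_ghost_edge e f :
    cohn_eq (TMul (TGhost e) (TEdge f))
            (if e == f then TVertex (range e) else TZero).

HB.instance Definition _ E K := gen_eqMixin (cohn_term E K).
HB.instance Definition _ E K := gen_choiceMixin (cohn_term E K).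

Section CohnAlgebra.
Variables (E : finGraph) (K : fieldType).
Implicit Types x y z : cohn_term E K.

Definition cohn_eqb : rel (cohn_term E K) := fun x y => `[< cohn_eq x y >].

Lemma cohn_eqb_refl : reflexive cohn_eqb.
Proof. by move=> x; apply/asboolP; exact: ceq_refl. Qed.

Lemma cohn_eqb_sym : symmetric cohn_eqb.
Proof. by move=> x y; apply/asboolP/asboolP; exact: ceq_sym. Qed.

Lemma cohn_eqb_trans : transitive cohn_eqb.
Proof.
by move=> y x z /asboolP xy /asboolP yz; apply/asboolP; exact: ceq_trans yz.
Qed.

Canonical cohn_equiv := EquivRel cohn_eqb cohn_eqb_refl cohn_eqb_sym
  cohn_eqb_trans.

Definition cohn : Type := {eq_quot cohn_equiv}.

HB.instance Definition _ := Choice.on cohn.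

Definition cpi x : cohn := \pi_({eq_quot cohn_equiv}) x.

Definition crepr (a : cohn) : cohn_term E K :=
  repr (a : {eq_quot cohn_equiv}).

Lemma creprK : cancel crepr cpi.
Proof. exact: reprK. Qed.

Lemma cpiP x y : cpi x = cpi y <-> cohn_eq x y.
Proof.
split=> [|xy]; first by move=> /eqmodP /asboolP.
by apply/eqmodP/asboolP.
Qed.

Lemma crepr_pi x : cohn_eq (crepr (cpi x)) x.
Proof. by apply/cpiP; rewrite creprK. Qed.

Lemma cohnW (P : cohn -> Prop) : (forall x, P (cpi x)) -> forall a, P a.
Proof. by move=> PP a; rewrite -(creprK a). Qed.

Definition cohn_vertex v : cohn := cpi (TVertex v).
Definition cohn_edge e : cohn := cpi (TEdge e).
Definition cohn_ghost e : cohn := cpi (TGhost e).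

Definition cohn_zero : cohn := cpi TZero.
Definition cohn_add (a b : cohn) : cohn := cpi (TAdd (crepr a) (crepr b)).
Definition cohn_opp (a : cohn) : cohn := cpi (TOpp (crepr a)).
Definition cohn_scale (k : K) (a : cohn) : cohn := cpi (TScale k (crepr a)).
Definition cohn_mul (a b : cohn) : cohn := cpi (TMul (crepr a) (crepr b)).

Lemma cohn_addE x y : cohn_add (cpi x) (cpi y) = cpi (TAdd x y).
Proof. by apply/cpiP; apply: ceq_add; exact: crepr_pi. Qed.

Lemma cohn_oppE x : cohn_opp (cpi x) = cpi (TOpp x).
Proof. by apply/cpiP; apply: ceq_opp; exact: crepr_pi. Qed.

Lemma cohn_scaleE k x : cohn_scale k (cpi x) = cpi (TScale k x).
Proof. by apply/cpiP; apply: ceq_scale; exact: crepr_pi. Qed.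

Lemma cohn_mulE x y : cohn_mul (cpi x) (cpi y) = cpi (TMul x y).
Proof. by apply/cpiP; apply: ceq_mul; exact: crepr_pi. Qed.

Lemma cohn_addA : associative cohn_add.
Proof.
elim/cohnW=> x; elim/cohnW=> y; elim/cohnW=> z.
by rewrite !cohn_addE; apply/cpiP; exact: ceq_addA.
Qed.

Lemma cohn_addC : commutative cohn_add.
Proof.
elim/cohnW=> x; elim/cohnW=> y.
by rewrite !cohn_addE; apply/cpiP; exact: ceq_addC.
Qed.

Lemma cohn_add0 : left_id cohn_zero cohn_add.
Proof.
by elim/cohnW=> x; rewrite cohn_addE; apply/cpiP; exact: ceq_add0.
Qed.

Lemma cohn_addN : left_inverse cohn_zero cohn_opp cohn_add.
Proof.
elim/cohnW=> x.
by rewrite cohn_oppE cohn_addE; apply/cpiP; exact: ceq_addN.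
Qed.

HB.instance Definition _ :=
  GRing.isZmodule.Build cohn cohn_addA cohn_addC cohn_add0 cohn_addN.

Definition cohn_one : cohn := \sum_(v : vertex E) cohn_vertex v.

Lemma cohn_mulA : associative cohn_mul.
Proof.
elim/cohnW=> x; elim/cohnW=> y; elim/cohnW=> z.
by rewrite !cohn_mulE; apply/cpiP; exact: ceq_mulA.
Qed.

Lemma cohn_mulDl : left_distributive cohn_mul +%R.
Proof.
elim/cohnW=> x; elim/cohnW=> y; elim/cohnW=> z.
rewrite /GRing.add /= cohn_addE !cohn_mulE cohn_addE.
by apply/cpiP; exact: ceq_mulDl.
Qed.

Lemma cohn_mulDr : right_distributive cohn_mul +%R.
Proof.
elim/cohnW=> x; elim/cohnW=> y; elim/cohnW=> z.
rewrite /GRing.add /= cohn_addE !cohn_mulE cohn_addE.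
by apply/cpiP; exact: ceq_mulDr.
Qed.

Lemma cohn_mul0l a : cohn_mul 0 a = 0.
Proof. by apply: (addrI (cohn_mul 0 a)); rewrite -cohn_mulDl !addr0. Qed.

Lemma cohn_mul0r a : cohn_mul a 0 = 0.
Proof. by apply: (addrI (cohn_mul a 0)); rewrite -cohn_mulDr !addr0. Qed.

Lemma cohn_scaleA k l a : cohn_scale k (cohn_scale l a) = cohn_scale (k * l) a.
Proof.
elim/cohnW: a => x.
by rewrite !cohn_scaleE; apply/cpiP; exact: ceq_scaleA.
Qed.

Lemma cohn_scale1 : left_id 1 cohn_scale.
Proof.
by elim/cohnW=> x; rewrite cohn_scaleE; apply/cpiP; exact: ceq_scale1.
Qed.

Lemma cohn_scaleDr : right_distributive cohn_scale +%R.
Proof.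
move=> k; elim/cohnW=> x; elim/cohnW=> y.
rewrite /GRing.add /= cohn_addE !cohn_scaleE cohn_addE.
by apply/cpiP; exact: ceq_scaleDr.
Qed.

Lemma cohn_scaleDl a : {morph cohn_scale^~ a : k l / k + l}.
Proof.
elim/cohnW: a => x k l.
rewrite !cohn_scaleE [RHS]cohn_addE.
by apply/cpiP; exact: ceq_scaleDl.
Qed.

Lemma cohn_scaleAl k a b : cohn_scale k (cohn_mul a b) = cohn_mul (cohn_scale k a) b.
Proof.
elim/cohnW: a => x; elim/cohnW: b => y.
by rewrite !(cohn_mulE, cohn_scaleE); apply/cpiP; exact: ceq_scaleAl.
Qed.

Lemma cohn_scaleAr k a b : cohn_scale k (cohn_mul a b) = cohn_mul a (cohn_scale k b).
Proof.
elim/cohnW: a => x; elim/cohnW: b => y.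
by rewrite !(cohn_mulE, cohn_scaleE); apply/cpiP; exact: ceq_scaleAr.
Qed.

Lemma cohn_vertexM v w :
  cohn_mul (cohn_vertex v) (cohn_vertex w) = if v == w then cohn_vertex w else 0.
Proof.
rewrite cohn_mulE; have /cpiP -> := ceq_vertex K v w.
by case: eqP.
Qed.

Lemma cohn_sumMl (F : vertex E -> cohn) a :
  cohn_mul (\sum_v F v) a = \sum_v cohn_mul (F v) a.
Proof.
by apply: (big_morph (cohn_mul^~ a)) => [b c|]; rewrite ?cohn_mul0l ?cohn_mulDl.
Qed.

Lemma cohn_sumMr (F : vertex E -> cohn) a :
  cohn_mul a (\sum_v F v) = \sum_v cohn_mul a (F v).
Proof.
by apply: (big_morph (cohn_mul a)) => [b c|]; rewrite ?cohn_mul0r ?cohn_mulDr.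
Qed.

Lemma cohn_mul1_vertex v a :
  cohn_mul (cohn_vertex v) a = a -> cohn_mul cohn_one a = a.
Proof.
move=> <-; rewrite cohn_mulA; congr (cohn_mul _ a).
rewrite cohn_sumMl (bigD1 v) //= cohn_vertexM eqxx big1 ?addr0 // => w /negbTE.
by rewrite cohn_vertexM => ->.
Qed.

Lemma cohn_vertex_mul1 v a :
  cohn_mul a (cohn_vertex v) = a -> cohn_mul a cohn_one = a.
Proof.
move=> <-; rewrite -cohn_mulA; congr (cohn_mul a _).
rewrite cohn_sumMr (bigD1 v) //= cohn_vertexM eqxx big1 ?addr0 // => w /negbTE.
by rewrite cohn_vertexM eq_sym => ->.
Qed.

Lemma cohn_mul1l : left_id cohn_one cohn_mul.
Proof.
elim/cohnW; elim=> [v|e|e||x IHx y IHy|x IHx|k x IHx|x IHx y IHy].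
- by apply: (@cohn_mul1_vertex v); rewrite cohn_vertexM eqxx.
- apply: (@cohn_mul1_vertex (source e)).
  by rewrite cohn_mulE; apply/cpiP; exact: ceq_source_edge.
- apply: (@cohn_mul1_vertex (range e)).
  by rewrite cohn_mulE; apply/cpiP; exact: ceq_range_ghost.
- exact: cohn_mul0r.
- by rewrite -cohn_addE [LHS]cohn_mulDr IHx IHy.
- rewrite -cohn_oppE; apply: (addIr (cpi x)).
  by rewrite -{2}IHx -cohn_mulDr !addNr cohn_mul0r.
- by rewrite -cohn_scaleE -cohn_scaleAr IHx.
- by rewrite -cohn_mulE cohn_mulA IHx.
Qed.

Lemma cohn_mul1r : right_id cohn_one cohn_mul.
Proof.
elim/cohnW; elim=> [v|e|e||x IHx y IHy|x IHx|k x IHx|x IHx y IHy].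
- by apply: (@cohn_vertex_mul1 v); rewrite cohn_vertexM eqxx.
- apply: (@cohn_vertex_mul1 (range e)).
  by rewrite cohn_mulE; apply/cpiP; exact: ceq_edge_range.
- apply: (@cohn_vertex_mul1 (source e)).
  by rewrite cohn_mulE; apply/cpiP; exact: ceq_ghost_source.
- exact: cohn_mul0l.
- by rewrite -cohn_addE [LHS]cohn_mulDl IHx IHy.
- rewrite -cohn_oppE; apply: (addIr (cpi x)).
  by rewrite -{2}IHx -cohn_mulDl !addNr cohn_mul0l.
- by rewrite -cohn_scaleE -cohn_scaleAl IHx.
- by rewrite -cohn_mulE -cohn_mulA IHy.
Qed.

(* Nontriviality: the terms act (on the right) on the K-valued functions on the
   pairs (v, p), where (v, e1 ... en) stands for the word e1 ... en v. *)
Let word := (vertex E * seq (edge E))%type.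
Let word_source (b : word) : vertex E :=
  if b.2 is e :: _ then source e else b.1.

Fixpoint cohn_act x (f : word -> K) : word -> K :=
  match x with
  | TVertex v => fun b => if word_source b == v then f b else 0
  | TEdge e => fun b => if word_source b == range e then f (b.1, e :: b.2) else 0
  | TGhost e => fun b => if b.2 is e' :: p then
        if (e' == e) && (word_source (b.1, p) == range e) then f (b.1, p) else 0
      else 0
  | TZero => fun=> 0
  | TAdd y z => fun b => cohn_act y f b + cohn_act z f b
  | TOpp y => fun b => - cohn_act y f b
  | TScale k y => fun b => k * cohn_act y f b
  | TMul y z => cohn_act z (cohn_act y f)
  end.

Lemma cohn_act_lin x k (f g : word -> K) b :
  cohn_act x (fun c => k * f c + g c) b = k * cohn_act x f b + cohn_act x g b.
Proof.
elim: x f g b => [v|e|e||x IHx y IHy|x IHx|l x IHx|x IHx y IHy] f g b /=.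
- by case: ifP; rewrite ?mulr0 ?addr0.
- by case: ifP; rewrite ?mulr0 ?addr0.
- by case: b => v [|e' p] /=; rewrite ?mulr0 ?addr0 //; case: ifP;
    rewrite ?mulr0 ?addr0.
- by rewrite mulr0 addr0.
- by rewrite IHx IHy mulrDr addrACA.
- by rewrite IHx opprD mulrN.
- by rewrite IHx mulrDr mulrCA.
- by rewrite -IHy; congr (cohn_act y _ b); apply/funext => c; exact: IHx.
Qed.

Lemma cohn_actP x y : cohn_eq x y -> cohn_act x = cohn_act y.
Proof.
have lin0 z : cohn_act z (fun=> 0) = fun=> 0.
  apply/funext => b; have := cohn_act_lin z (-1) (fun=> 0) (fun=> 0) b.
  by rewrite mulr0 addr0 mulN1r addNr.
elim=> {x y} //=.
- by move=> x y z _ -> _ ->.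
- by move=> x x' y y' _ -> _ ->.
- by move=> x x' _ ->.
- by move=> k x x' _ ->.
- by move=> x x' y y' _ -> _ ->.
- by move=> x y z; apply/funext => f; apply/funext => b; rewrite addrA.
- by move=> x y; apply/funext => f; apply/funext => b; rewrite addrC.
- by move=> x; apply/funext => f; apply/funext => b; rewrite add0r.
- by move=> x; apply/funext => f; apply/funext => b; rewrite addNr.
- by move=> k l x; apply/funext => f; apply/funext => b; rewrite mulrA.
- by move=> x; apply/funext => f; apply/funext => b; rewrite mul1r.
- by move=> k x y; apply/funext => f; apply/funext => b; rewrite mulrDr.
- by move=> k l x; apply/funext => f; apply/funext => b; rewrite mulrDl.
- move=> x y z; apply/funext => f; apply/funext => b.
  rewrite -[X in X + _]mul1r -cohn_act_lin; congr (cohn_act z _ b).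
  by apply/funext => c; rewrite mul1r.
- move=> k x y; apply/funext => f; apply/funext => b.
  have := cohn_act_lin y k (cohn_act x f) (fun=> 0) b.
  rewrite lin0 addr0 => <-; congr (cohn_act y _ b).
  by apply/funext => c; rewrite addr0.
- move=> v w; apply/funext => f; apply/funext => b.
  case: (eqVneq v w) => [->|vw] /=; first by case: (eqVneq (word_source b) w).
  by case: (eqVneq (word_source b) w) => // ->; rewrite eq_sym (negbTE vw).
- move=> e; apply/funext => f; apply/funext => b.
  by rewrite {2}/word_source /= eqxx.
- by move=> e; apply/funext => f; apply/funext => b; case: (word_source b == _).
- move=> e; apply/funext => f; apply/funext => -[v [|e' p]] //=.
  by case: (eqVneq e' e); case: (eqVneq (word_source _) (range e)).
- move=> e; apply/funext => f; apply/funext => -[v [|e' p]] /=.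
    by rewrite if_same.
  by case: (eqVneq e' e) => [->|_] /=; rewrite ?eqxx ?if_same.
- move=> e g; apply/funext => f; apply/funext => -[v p] /=.
  case: (eqVneq e g) => [->|_] /=; last by rewrite if_same.
  by case: (eqVneq (word_source _) (range g)).
Qed.

Lemma cohn_one_neq0 : cohn_one != 0.
Proof.
have /card_gt0P [v _] := vertex_nonempty E.
apply/eqP => one0.
have : cohn_vertex v = 0.
  by rewrite -[cohn_vertex v]cohn_mul1l one0 cohn_mul0l.
move=> /cpiP /cohn_actP /(congr1 (fun h => h (fun=> 1) (v, [::]))) /=.
by rewrite /word_source eqxx => /eqP; rewrite oner_eq0.
Qed.

HB.instance Definition _ := GRing.Zmodule_isNzRing.Build cohn
  cohn_mulA cohn_mul1l cohn_mul1r cohn_mulDl cohn_mulDr cohn_one_neq0.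

HB.instance Definition _ := GRing.Zmodule_isLmodule.Build K cohn
  cohn_scaleA cohn_scale1 cohn_scaleDr cohn_scaleDl.

HB.instance Definition _ := GRing.Lmodule_isLalgebra.Build K cohn cohn_scaleAl.

HB.instance Definition _ := GRing.Lalgebra_isAlgebra.Build K cohn cohn_scaleAr.

End CohnAlgebra.

(* Right R-modules are left modules over the converse ring R^c; in particular
   'rV[R^c]_n is the right module R^n, and (R^c)^o is R as a right module. *)
Notation rmodType R := (lmodType (R^c)).

Definition mod_iso (R : pzRingType) (P Q : lmodType R) : Prop :=
  exists f : {linear P -> Q}, bijective f.

Definition directly_finite (R : nzRingType) : Prop :=
  forall a b : R, a * b = 1 -> b * a = 1.

Definition stably_finite (R : nzRingType) : Prop :=
  forall (n : nat) (Q : rmodType R), (0 < n)%N ->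
    mod_iso 'rV[R^c]_n ('rV[R^c]_n * Q)%type -> forall q : Q, q = 0.

Definition hermite (R : nzRingType) : Prop :=
  forall (m n : nat) (Q : rmodType R), (0 < m)%N -> (0 < n)%N ->
    mod_iso 'rV[R^c]_n ('rV[R^c]_m * Q)%type ->
    (m <= n)%N /\ mod_iso Q 'rV[R^c]_(n - m).

Definition finitely_generated (R : pzRingType) (P : lmodType R) : Prop :=
  exists (n : nat) (x : 'I_n -> P),
    forall p : P, exists c : 'I_n -> R, p = \sum_(i < n) c i *: x i.

Definition projective (R : pzRingType) (P : lmodType R) : Prop :=
  forall (M N : lmodType R) (g : {linear M -> N}) (f : {linear P -> N}),
    (forall y : N, exists x : M, g x = y) ->
    exists h : {linear P -> M}, forall p : P, g (h p) = f p.

Definition cancellation_of_projectives (R : nzRingType) : Prop :=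
  forall P P' : rmodType R,
    finitely_generated P -> projective P ->
    finitely_generated P' -> projective P' ->
    mod_iso (P * (R^c)^o)%type (P' * (R^c)^o)%type -> mod_iso P P'.

(* Main.v *)
From HB Require Import structures.
Require Import Defs.
From mathcomp Require Import all_boot all_algebra boolp.

(* For every ring, cancellation of projectives implies Hermite, Hermite implies
   stably finite and stably finite implies directly finite.  A cycle based at v
   is a path c with c^* c = v but c c^* <> v, so c + (1 - v) has a one-sided
   inverse only.

   Conversely, put q_v = v - \sum_(s(e) = v) e e^*.  Then q_v e = 0 = e^* q_v,
   so q_v C q_w is K q_v if v = w and 0 otherwise.  If E is acyclic, then
   v = q_v + \sum_(s(e) = v) e r(e) e^* shows by induction along the edges that
   the q_v generate C as an ideal.  A right module M is therefore determined by
   the dimensions of the vector spaces M q_v, and these dimensions are finite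
   and additive when M is finitely generated. *)

Set Implicit Arguments.
Unset Strict Implicit.
Unset Printing Implicit Defensive.

Import GRing.Theory.
Local Open Scope ring_scope.

(** * Isomorphisms, finite generation and projectivity of modules *)

Definition linear_pack (R : pzRingType) (U V : lmodType R) (f : U -> V)
  (lf : linear f) : {linear U -> V} :=
  HB.pack f (GRing.isLinear.Build R U V *:%R f lf).

Section ModIso.
Variable R : pzRingType.
Implicit Types P Q M N : lmodType R.

Lemma mod_isoP P Q :
  mod_iso P Q <->
  exists (f : {linear P -> Q}) (g : {linear Q -> P}), cancel f g /\ cancel g f.
Proof.
split=> [[f [g fK gK]]|[f [g [fK gK]]]]; last by exists f; exists g.
have lg : linear g.
  by move=> a x y; apply: (can_inj fK); rewrite linearP !gK.
by exists f, (linear_pack lg).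
Qed.

Lemma mod_iso_can P Q (f : P -> Q) (g : Q -> P) :
  linear f -> cancel f g -> cancel g f -> mod_iso P Q.
Proof. by move=> lf fK gK; exists (linear_pack lf), g. Qed.

Lemma mod_iso_sym P Q : mod_iso P Q -> mod_iso Q P.
Proof. by move=> /mod_isoP[f [g [fK gK]]]; exists g, f. Qed.

Lemma mod_iso_trans Q P M : mod_iso P Q -> mod_iso Q M -> mod_iso P M.
Proof.
move=> [f bf] [g bg]; exists (g \o f); exact: bij_comp.
Qed.

Lemma mod_iso_prod P P' Q Q' : mod_iso P P' -> mod_iso Q Q' ->
  mod_iso (P * Q)%type (P' * Q')%type.
Proof.
move=> /mod_isoP[f [f' [fK f'K]]] /mod_isoP[g [g' [gK g'K]]].
apply: (@mod_iso_can _ _ (fun x => (f x.1, g x.2)) (fun x => (f' x.1, g' x.2))).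
- by move=> a x y; rewrite /= !linearP.
- by move=> [x y]; rewrite /= fK gK.
- by move=> [x y]; rewrite /= f'K g'K.
Qed.

Lemma mod_iso_refl P : mod_iso P P.
Proof. by exists idfun; exists id. Qed.

Lemma mod_iso_prodA P Q M : mod_iso (P * (Q * M))%type (P * Q * M)%type.
Proof.
apply: (@mod_iso_can _ _ (fun x => (x.1, x.2.1, x.2.2))
  (fun x => (x.1.1, (x.1.2, x.2)))) => //.
- by move=> [x [y z]].
- by move=> [[x y] z].
Qed.

Lemma mod_iso_prodC P Q : mod_iso (P * Q)%type (Q * P)%type.
Proof.
by apply: (@mod_iso_can _ _ (fun x => (x.2, x.1)) (fun x => (x.2, x.1)))
  => // -[].
Qed.

Lemma mod_iso_row_add m n :
  mod_iso 'rV[R]_(m + n) ('rV[R]_m * 'rV[R]_n)%type.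
Proof.
apply: (@mod_iso_can _ _ (fun x => (lsubmx x, rsubmx x))
  (fun x => row_mx x.1 x.2)).
- by move=> a x y; rewrite !linearP.
- by move=> x; rewrite hsubmxK.
- by move=> [x y]; rewrite row_mxKl row_mxKr.
Qed.

Lemma mod_iso_row1 : mod_iso 'rV[R]_1 R^o.
Proof.
apply: (@mod_iso_can _ _ (fun x : 'rV[R]_1 => x 0 0 : R^o)
  (fun a : R^o => const_mx a)).
- by move=> a x y; rewrite !mxE.
- by move=> x; apply/rowP => i; rewrite mxE ord1.
- by move=> a; rewrite mxE.
Qed.

Lemma mod_iso_row0 P : mod_iso ('rV[R]_0 * P)%type P.
Proof.
apply: (@mod_iso_can _ _ (fun x => x.2) (fun x => (0, x))) => //.
by move=> [x y]; rewrite [x]thinmx0.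
Qed.

Lemma finitely_generated_surj P Q (f : {linear P -> Q}) (g : Q -> P) :
  cancel g f -> finitely_generated P -> finitely_generated Q.
Proof.
move=> gK [n [x xP]]; exists n, (f \o x) => q.
have [c gq] := xP (g q); exists c.
by rewrite -[LHS]gK gq linear_sum; apply: eq_bigr => i _; rewrite linearZ.
Qed.

Lemma finitely_generated_row n : finitely_generated 'rV[R]_n.
Proof.
exists n, (fun i => delta_mx 0 i) => p; exists (fun i => p 0 i).
exact: row_sum_delta.
Qed.

Lemma finitely_generated_prod P Q : finitely_generated P ->
  finitely_generated Q -> finitely_generated (P * Q)%type.
Proof.
move=> [m [x xP]] [n [y yQ]].
exists (m + n)%N, (fun i =>
  match split i with inl j => (x j, 0) | inr j => (0, y j) end).
move=> [p q]; have [c ->] := xP p; have [d ->] := yQ q.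
exists (fun i => match split i with inl j => c j | inr j => d j end).
have sumE I (r : seq I) (F : I -> P * Q) :
    \sum_(i <- r) F i = (\sum_(i <- r) (F i).1, \sum_(i <- r) (F i).2).
  by elim: r => [|i r IH]; rewrite ?big_nil // !big_cons IH.
rewrite sumE !big_split_ord /=; congr (_, _).
  rewrite [X in _ + X]big1 ?addr0 => [|i _].
    by apply: eq_bigr => i _; rewrite (unsplitK (inl i)).
  by rewrite (unsplitK (inr i)) scaler0.
rewrite [X in X + _]big1 ?add0r => [|i _].
  by apply: eq_bigr => i _; rewrite (unsplitK (inr i)).
by rewrite (unsplitK (inl i)) scaler0.
Qed.

Lemma projective_retract P Q (f : {linear P -> Q}) (g : {linear Q -> P}) :
  cancel g f -> projective P -> projective Q.
Proof.
move=> gK pP M N h k sh; have [l lP] := pP M N h (k \o f : {linear P -> N}) sh.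
by exists (l \o g) => q; rewrite /= lP /= gK.
Qed.

Lemma projective_row n : projective 'rV[R]_n.
Proof.
move=> M N g f /choice[s sP].
have lh : linear (fun x : 'rV[R]_n => \sum_i x 0 i *: s (f (delta_mx 0 i))).
  move=> a x y; rewrite scaler_sumr -big_split; apply: eq_bigr => i _.
  by rewrite !mxE scalerDl scalerA.
exists (linear_pack lh) => x /=.
rewrite [x in RHS]row_sum_delta !linear_sum; apply: eq_bigr => i _.
by rewrite !linearZ /= sP.
Qed.

Lemma projective_prod P Q : projective P -> projective Q ->
  projective (P * Q)%type.
Proof.
move=> pP pQ M N g f sg.
have l1 : linear (fun x : P => f (x, 0)).
  by move=> a x y; rewrite -linearP; congr (f (_, _)); rewrite /= scaler0 addr0.
have l2 : linear (fun y : Q => f (0, y)).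
  by move=> a x y; rewrite -linearP; congr (f (_, _)); rewrite /= scaler0 addr0.
have [h hP] := pP _ _ g (linear_pack l1) sg.
have [k kP] := pQ _ _ g (linear_pack l2) sg.
have lhk : linear (fun x : P * Q => h x.1 + k x.2).
  by move=> a x y /=; rewrite !linearP /= scalerDr addrACA.
exists (linear_pack lhk) => -[p q] /=.
by rewrite linearD hP kP /= -linearD; congr (f (_, _));
  rewrite /= ?addr0 ?add0r.
Qed.

End ModIso.

(** * Implications that hold over every ring *)

Section GeneralRings.
Variable R : nzRingType.

Lemma cancel_row (P P' : rmodType R) m : cancellation_of_projectives R ->
  finitely_generated P -> projective P ->
  finitely_generated P' -> projective P' ->
  mod_iso ('rV[R^c]_m * P)%type ('rV[R^c]_m * P')%type -> mod_iso P P'.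
Proof.
move=> canR fP pP fP' pP'; elim: m => [|m IHm] iso.
  apply: mod_iso_trans (mod_iso_row0 P').
  exact: mod_iso_trans (mod_iso_sym (mod_iso_row0 P)) _.
apply: IHm.
(* One copy of [R] is split off and moved to the right, where the cancellation hypothesis expects
   it. *)
have isoS (M : rmodType R) :
    mod_iso ('rV[R^c]_m.+1 * M)%type ('rV[R^c]_m * M * (R^c)^o)%type.
  apply: (@mod_iso_trans _ ((R^c)^o * ('rV[R^c]_m * M))%type);
    last exact: mod_iso_prodC.
  apply: mod_iso_trans (mod_iso_sym (mod_iso_prodA _ _ _)).
  apply: mod_iso_prod (mod_iso_refl _).
  apply: (mod_iso_trans (@mod_iso_row_add R^c 1 m)).
  exact: mod_iso_prod (mod_iso_row1 _) (mod_iso_refl _).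
apply: canR.
- exact: finitely_generated_prod (finitely_generated_row _ _) fP.
- exact: projective_prod (@projective_row _ _) pP.
- exact: finitely_generated_prod (finitely_generated_row _ _) fP'.
- exact: projective_prod (@projective_row _ _) pP'.
exact: mod_iso_trans (mod_iso_sym (isoS P)) (mod_iso_trans iso (isoS P')).
Qed.

(** [Q] is a retract of [R^n], hence finitely generated projective, so free summands can be
    cancelled next to it. If [m <= n], cancel [R^m] from [R^n]; if [n < m], cancelling [R^n] would
    leave a nonzero free summand inside the zero module. *)
Lemma cancellation_hermite : cancellation_of_projectives R -> hermite R.
Proof.
move=> canR m n Q m0 n0 iso.
have [f [g [fK gK]]] := (mod_isoP _ _).1 iso.
pose s : {linear 'rV[R^c]_n -> Q} := snd \o f.
have li : linear (fun q : Q => (0, q) : 'rV[R^c]_m * Q).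
  by move=> a x y; congr (_, _); rewrite /= scaler0 addr0.
have sK : cancel (g \o linear_pack li) s by move=> q; rewrite /s /= gK.
have fQ := finitely_generated_surj sK (finitely_generated_row _ n).
have pQ := projective_retract sK (@projective_row _ n).
case: (leqP m n) => [mn|lt_nm].
  split=> //; apply/mod_iso_sym/(@cancel_row _ _ m) => //.
  - exact: finitely_generated_row.
  - exact: projective_row.
  apply: mod_iso_trans iso.
  by have := mod_iso_row_add R^c m (n - m); rewrite subnKC // => /mod_iso_sym.
have nm := ltnW lt_nm.
have : mod_iso 'rV[R^c]_0 ('rV[R^c]_(m - n) * Q)%type.
  apply: (@cancel_row _ _ n) => //.
  - exact: finitely_generated_row.
  - exact: projective_row.
  - exact: finitely_generated_prod (finitely_generated_row _ _) fQ.
  - exact: projective_prod (@projective_row _ _) pQ.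
  apply: (mod_iso_trans (mod_iso_prodC _ _)).
  apply: (mod_iso_trans (mod_iso_row0 _)).
  apply: (mod_iso_trans iso).
  apply: mod_iso_trans (mod_iso_sym (mod_iso_prodA _ _ _)).
  apply: mod_iso_prod (mod_iso_refl _).
  by have := mod_iso_row_add R^c n (m - n); rewrite subnKC.
move=> [e [e' _ e'K]].
(* The inverse [e'] takes values in the one-element module [R^0], so every element of its source is
   0, even the constant row 1. *)
have : (const_mx 1 : 'rV[R^c]_(m - n), 0 : Q) = 0.
  by rewrite -[LHS]e'K [e' _]thinmx0 linear0.
move: lt_nm; rewrite -subn_gt0; case: (m - n)%N => // k _ [].
by move=> /rowP/(_ 0)/eqP; rewrite !mxE oner_eq0.
Qed.
Lemma hermite_stably_finite : hermite R -> stably_finite R.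
Proof.
move=> hR n Q n0 /(hR n n Q n0 n0)[_]; rewrite subnn => -[f [g fK _]] q.
by rewrite -[q]fK -[RHS]fK; congr (g _); rewrite [LHS]thinmx0 [RHS]thinmx0.
Qed.
End GeneralRings.

(** * Split surjections and direct finiteness *)

Section Kernel.
Variables (R : pzRingType) (P Q : lmodType R) (f : {linear P -> Q}).

Definition lkernel : {pred P} := [pred x | f x == 0].

Lemma lkernel_submod : submod_closed lkernel.
Proof.
split=> [|a x y]; rewrite !inE ?linear0 // linearP => /eqP -> /eqP ->.
by rewrite scaler0 addr0.
Qed.

HB.instance Definition _ :=
  GRing.isSubmodClosed.Build R P lkernel lkernel_submod.

Record lker_type := LkerType { lker_val :> P; _ : lker_val \in lkernel }.
HB.instance Definition _ := [isSub for lker_val].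
HB.instance Definition _ := [Choice of lker_type by <:].
HB.instance Definition _ := [SubChoice_isSubLmodule of lker_type by <:].

(** The splitting is [x = g (f x) + (x - g (f x))], whose second summand lies in the kernel. *)
Lemma mod_iso_split (g : {linear Q -> P}) :
  cancel g f -> mod_iso P (Q * lker_type)%type.
Proof.
move=> gK.
have kerP x : x - g (f x) \in lkernel by rewrite inE linearB gK subrr.
apply: (@mod_iso_can _ _ _ (fun x => (f x, LkerType (kerP x)))
  (fun y => g y.1 + lker_val y.2)).
- move=> a x y; congr (_, _); first by rewrite linearP.
  by apply: val_inj; rewrite /= !linearP /= scalerDr addrACA.
- by move=> x; rewrite /= addrC subrK.
- move=> [y [z kz]] /=; have /eqP fz : f z == 0 by [].
  congr (_, _); first by rewrite linearD gK fz addr0.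
  by apply: val_inj; rewrite /= linearD gK fz addr0 addrC addKr.
Qed.

End Kernel.

(** Left multiplications are endomorphisms of the right module [R]. If [a b = 1], multiplication by
    [b] is a section of multiplication by [a], so the kernel of the latter is a complement of [R] in
    [R] and vanishes; it contains [1 - b a]. *)
Lemma stably_finite_directly_finite (R : nzRingType) :
  stably_finite R -> directly_finite R.
Proof.
move=> sfR a b ab1.
have lmul (c : R) :
    linear (fun x : 'rV[R^c]_1 => const_mx (c * x 0 0) : 'rV[R^c]_1).
  by move=> k x y; apply/rowP => i; rewrite !mxE [LHS]mulrDr mulrA.
pose f c := linear_pack (lmul c).
have fK : cancel (f b) (f a).
  by move=> x; apply/rowP => i; rewrite /= !mxE mulrA ab1 mul1r ord1.
have lker0 := sfR 1%N _ isT (mod_iso_split fK).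
have kerP : const_mx (1 - b * a) \in lkernel (f a).
  rewrite inE; apply/eqP/rowP => i.
  by rewrite !mxE mulrBr mulrA ab1 mul1r mulr1 subrr.
have /(congr1 val)/rowP/(_ 0) := lker0 (LkerType kerP).
by rewrite !mxE => /eqP; rewrite subr_eq0 => /eqP.
Qed.

(** * Cycles and one-sided inverses in the Cohn path algebra *)

Section CohnRelations.
Variables (E : finGraph) (K : fieldType).
Local Notation C := (cohn E K).
Local Notation vtx := (cohn_vertex K).
Local Notation edg := (cohn_edge K).
Local Notation gho := (cohn_ghost K).

Lemma vertexM v w : vtx v * vtx w = (vtx w *+ (v == w)) :> C.
Proof. by rewrite [LHS]cohn_vertexM; case: eqP; rewrite ?mulr1n ?mulr0n. Qed.

Lemma source_edge e : vtx (source e) * edg e = edg e :> C.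
Proof. by rewrite [LHS]cohn_mulE; apply/cpiP; exact: ceq_source_edge. Qed.

Lemma edge_range e : edg e * vtx (range e) = edg e :> C.
Proof. by rewrite [LHS]cohn_mulE; apply/cpiP; exact: ceq_edge_range. Qed.

Lemma range_ghost e : vtx (range e) * gho e = gho e :> C.
Proof. by rewrite [LHS]cohn_mulE; apply/cpiP; exact: ceq_range_ghost. Qed.

Lemma ghost_source e : gho e * vtx (source e) = gho e :> C.
Proof. by rewrite [LHS]cohn_mulE; apply/cpiP; exact: ceq_ghost_source. Qed.

Lemma ghost_edge e f : gho e * edg f = vtx (range e) *+ (e == f) :> C.
Proof.
rewrite [LHS]cohn_mulE; have /cpiP -> := ceq_ghost_edge K e f.
by case: eqP.
Qed.

Definition path_elt (p : seq (edge E)) : C := \prod_(e <- p) edg e.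
Definition ghost_path_elt (p : seq (edge E)) : C := \prod_(e <- rev p) gho e.

(** The innermost pair [e^* e] collapses to [r(e) = s(f)], which the next edge [f] absorbs. *)
Lemma ghost_path_elt_path e p :
  path (fun e f => range e == source f) e p ->
  ghost_path_elt (e :: p) * path_elt (e :: p) = vtx (range (last e p)).
Proof.
rewrite /ghost_path_elt /path_elt.
elim: p e => [|f p IHp] e /=.
  by rewrite rev_cons /rev /= !big_seq1 ghost_edge eqxx.
move=> /andP[/eqP ef fp]; rewrite -(IHp f fp).
rewrite rev_cons big_rcons [in LHS]big_cons.
rewrite -!mulrA (mulrA (gho e)) ghost_edge eqxx mulr1n ef.
by rewrite big_cons (mulrA (vtx _)) source_edge.
Qed.

Lemma directly_finite_acyclic : directly_finite (cohn E K) -> acyclic E.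
Proof.
move=> dfC [[|e p] /andP[/andP[// _ /= cyc] _]].
set v := source e; set c := path_elt (e :: p); set d := ghost_path_elt (e :: p).
have [ep pe] :
    path (fun e f => range e == source f) e p /\ range (last e p) = v.
  by move: cyc; rewrite rcons_path => /andP[? /eqP].
have dc : d * c = vtx v by rewrite -pe; exact: ghost_path_elt_path.
have vv : vtx v * vtx v = vtx v by rewrite vertexM eqxx.
have vc : vtx v * c = c by rewrite /c /path_elt big_cons mulrA source_edge.
have cv : c * vtx v = c.
  rewrite /c /path_elt -pe lastI big_rcons -mulrA; congr (_ * _).
  exact: edge_range.
have dv : d * vtx v = d.
  by rewrite /d /ghost_path_elt rev_cons big_rcons -mulrA ghost_source.
have vd : vtx v * d = d.
  rewrite /d /ghost_path_elt -pe lastI rev_rcons big_cons mulrA.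
  congr (_ * _); exact: range_ghost.
have ww : (1 - vtx v) * (1 - vtx v) = 1 - vtx v.
  by rewrite mulrBl mul1r mulrBr mulr1 vv subrr subr0.
(* [d] is a left inverse of [c] relative to [v]; adding the complementary idempotent [1 - v] to both
   makes it one relative to 1. *)
have /dfC : (d + (1 - vtx v)) * (c + (1 - vtx v)) = 1.
  rewrite mulrDl [d * _]mulrDr [X in _ + X]mulrDr ww dc mulrBr mulrBl.
  by rewrite mulr1 mul1r dv vc !subrr addr0 add0r addrC subrK.
(* Expanding the reversed product leaves [c * d = v]. *)
rewrite mulrDl [c * _]mulrDr [X in _ + X]mulrDr ww mulrBr mulrBl.
rewrite mulr1 mul1r cv vd !subrr addr0 add0r addrCA => /(canRL (addKr _)).
rewrite addNr => /subr0_eq.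
(* At the empty word based at [v] a ghost edge acts as zero, while [v] acts as
   the identity. *)
rewrite /d /ghost_path_elt rev_cons big_rcons mulrA.
rewrite -[c * _]creprK [X in X = _]cohn_mulE => /cpiP/cohn_actP.
move=> /(congr1 (fun h => h (fun=> 1) (v, [::]))) /=.
by rewrite eqxx => /esym/eqP; rewrite oner_eq0.
Qed.
End CohnRelations.

(** * Finite-dimensional images of projections *)

Section FiniteDimension.
Variable K : fieldType.

(** [s] parametrises the image of the projection [p], possibly with redundancy. A nonzero [c] with
    [s c = 0] allows restricting [s] to a complement of [c] without changing its image; once [s] is
    injective, [p] followed by the inverse of [s] is the required [g]. *)
Lemma row_section (V : lmodType K) (p : {linear V -> V}) n
    (s : {linear 'rV[K]_n -> V}) :
  (forall c, p (s c) = s c) -> (forall x, exists c, p x = s c) ->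
  exists (d : nat) (f : {linear 'rV[K]_d -> V}) (g : {linear V -> 'rV[K]_d}),
    (forall x, f (g x) = p x) /\ cancel f g.
Proof.
elim/ltn_ind: n s => n IHn s ps imp.
have [[c c0 sc0]|injs] := pselect (exists2 c, c != 0 & s c = 0).
  have ltn : (\rank c^C%MS < n)%N.
    rewrite mxrank_compl rank_rV c0 subn1 ltn_predL.
    by case: n c c0 {IHn s ps imp sc0} => // c; rewrite [c]thinmx0 eqxx.
  have ls : linear (fun r : 'rV_(\rank c^C%MS) => s (r *m row_base c^C%MS)).
    by move=> a x y; rewrite mulmxDl -scalemxAl linearP.
  apply: (IHn _ ltn (linear_pack ls)) => [r|x]; first exact: ps.
  have [y ->] := imp x.
  have /sub_addsmxP[[a b] /= ->] : (y <= c + row_base c^C%MS)%MS.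
    apply: submx_trans (submx_full y (addsmx_compl_full c)) _.
    by rewrite addsmxS // eq_row_base.
  exists b; rewrite linearD /= [a]mx11_scalar mul_scalar_mx linearZ sc0 /=.
  by rewrite scaler0 add0r.
have [g gP] := choice imp.
have sI c : s c = 0 -> c = 0.
  by move=> sc; apply: contra_notP injs => /eqP; exists c.
have sinj : injective s.
  by move=> x y xy; apply/subr0_eq/sI; rewrite linearB xy subrr.
have lg : linear g.
  by move=> a x y; apply: sinj; rewrite -gP !linearP /= !gP.
exists n, s, (linear_pack lg); split=> // c.
by apply: sinj; rewrite -gP ps.
Qed.

(** The identity matrix of rank [m] factors through a matrix with [n] columns. *)
Lemma row_retract_leq m n (f : {linear 'rV[K]_m -> 'rV[K]_n})
    (g : {linear 'rV[K]_n -> 'rV[K]_m}) : cancel f g -> (m <= n)%N.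
Proof.
move=> fK; have fg1 : lin1_mx f *m lin1_mx g = 1%:M.
  by apply/row_matrixP => i; rewrite !rowE mulmxA !mul_rV_lin1 /= fK mulmx1.
rewrite -{1}(mxrank1 K m) -fg1.
exact: leq_trans (mxrankM_maxl _ _) (rank_leq_col _).
Qed.

End FiniteDimension.

(** * Right modules over a [K]-algebra as vector spaces *)

Section RightModules.
Variables (K : fieldType) (R : algType K).

(** A separate name for the carrier of [M], so that scaling by [K] does not compete with scaling by
    [R^c]. *)
Definition restr_scalars (M : rmodType R) : Type := M.
HB.instance Definition _ M := GRing.Zmodule.on (restr_scalars M).

Section Scalars.
Variable M : rmodType R.
Implicit Types (x y : M) (a b : R).

Definition ract x a : M := (a : R^c) *: x.

Lemma ractM x a b : ract x (a * b) = ract (ract x a) b.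
Proof. by rewrite /ract scalerA. Qed.

Lemma ract1 x : ract x 1 = x.
Proof. exact: scale1r. Qed.

Lemma ractDl x y a : ract (x + y) a = ract x a + ract y a.
Proof. exact: scalerDr. Qed.

Lemma ractDr x a b : ract x (a + b) = ract x a + ract x b.
Proof. exact: scalerDl. Qed.

Lemma ract0 x : ract x 0 = 0.
Proof. exact: scale0r. Qed.

Lemma ract_suml I (r : seq I) (F : I -> M) a :
  ract (\sum_(i <- r) F i) a = \sum_(i <- r) ract (F i) a.
Proof. exact: scaler_sumr. Qed.

Lemma ract_sumr I (r : seq I) x (F : I -> R) :
  ract x (\sum_(i <- r) F i) = \sum_(i <- r) ract x (F i).
Proof. exact: scaler_suml. Qed.

Definition restr_scale (k : K) (x : restr_scalars M) : restr_scalars M :=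
  ract x k%:A.

Fact restr_scaleA k l x :
  restr_scale k (restr_scale l x) = restr_scale (k * l) x.
Proof. by rewrite /restr_scale -ractM mulr_algl scalerA mulrC. Qed.

Fact restr_scale1 : left_id 1 restr_scale.
Proof. by move=> x; rewrite /restr_scale scale1r ract1. Qed.

Fact restr_scaleDr : right_distributive restr_scale +%R.
Proof. by move=> k x y; apply: ractDl. Qed.

Fact restr_scaleDl x : {morph restr_scale^~ x : k l / k + l}.
Proof. by move=> k l; rewrite /restr_scale scalerDl ractDr. Qed.

HB.instance Definition _ := GRing.Zmodule_isLmodule.Build K (restr_scalars M)
  restr_scaleA restr_scale1 restr_scaleDr restr_scaleDl.

Lemma ractZr k x a : ract x (k *: a) = k *: (ract x a : restr_scalars M).
Proof. by rewrite -mulr_algr ractM. Qed.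

Lemma ractZl k (x : restr_scalars M) a :
  ract (k *: x) a = k *: (ract x a : restr_scalars M).
Proof. by rewrite -ractZr /GRing.scale/= /restr_scale -ractM mulr_algl. Qed.

Lemma ract_linear a :
  linear (fun x : restr_scalars M => ract x a : restr_scalars M).
Proof. by move=> k x y; rewrite ractDl ractZl. Qed.

End Scalars.

Lemma restr_linear (M N : rmodType R) (h : {linear M -> N}) :
  linear (h : restr_scalars M -> restr_scalars N).
Proof. by move=> k x y; rewrite linearD [h (k *: x)]linearZ. Qed.

(* The vector space [M q] has dimension [d]: [f] maps the rows isomorphically
   onto it and [f \o g] is the projection [x |-> x q]. *)
Definition corner_dim (q : R) (M : rmodType R) (d : nat) : Prop :=
  exists (f : {linear 'rV[K]_d -> restr_scalars M})
         (g : {linear restr_scalars M -> 'rV[K]_d}),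
    (forall x, f (g x) = ract x q) /\ cancel f g.

(** [h] and [h'] commute with right multiplication by [q], so they restrict to a retraction between
    [M q] and [N q]; [a] and [b] are these restrictions in coordinates. *)
Lemma corner_dim_retract q (M N : rmodType R) m n (h : {linear M -> N})
    (h' : {linear N -> M}) : cancel h h' ->
  corner_dim q M m -> corner_dim q N n -> (m <= n)%N.
Proof.
move=> hK [f [g [fg gf]]] [f' [g' [fg' gf']]].
pose a : {linear 'rV[K]_m -> 'rV[K]_n} :=
  g' \o (linear_pack (restr_linear h) \o f).
pose b : {linear 'rV[K]_n -> 'rV[K]_m} :=
  g \o (linear_pack (restr_linear h') \o f').
apply: (@row_retract_leq _ _ _ a b) => x.
rewrite /a /b /= fg' [h' _]linearZ hK.
by have /= := fg (f x); rewrite /ract => <-; rewrite !gf.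
Qed.

Lemma corner_dim_iso q (M N : rmodType R) m n : mod_iso M N ->
  corner_dim q M m -> corner_dim q N n -> m = n.
Proof.
move=> /mod_isoP[h [h' [hK h'K]]] dM dN; apply/eqP; rewrite eqn_leq.
by rewrite (corner_dim_retract hK dM dN) (corner_dim_retract h'K dN dM).
Qed.

Lemma corner_dim_prod q (M N : rmodType R) m n :
  corner_dim q M m -> corner_dim q N n -> corner_dim q (M * N)%type (m + n).
Proof.
move=> [f [g [fg gf]]] [f' [g' [fg' gf']]].
have lF : linear (fun c : 'rV[K]_(m + n) =>
    (f (lsubmx c), f' (rsubmx c)) : restr_scalars (M * N)%type).
  by move=> k x y; rewrite !linearP.
have lG : linear (fun x : restr_scalars (M * N)%type =>
    row_mx (g x.1) (g' x.2)).
  by move=> k x y; rewrite scale_row_mx add_row_mx -!linearP.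
exists (linear_pack lF), (linear_pack lG); split=> [x|c] /=.
  by rewrite row_mxKl row_mxKr fg fg'.
by rewrite gf gf' hsubmxK.
Qed.

End RightModules.

(** * Algebras generated as an ideal by idempotents with scalar corners *)

Section FullCorner.
Variables (K : fieldType) (R : algType K) (V : finType) (q : V -> R).
Hypothesis corner : forall v w a,
  exists k : K, q v * a * q w = k *: q v *+ (v == w).
Hypothesis idem : forall v, q v * q v = q v.
Variables (n : nat) (t : 'I_n -> V) (u w : 'I_n -> R).
Hypothesis full : \sum_i u i * q (t i) * w i = 1.

(** Idempotence lets each factor keep its own copy of [q (t i)]. The decomposition of 1 into the
    [U i * W i] is what gets inserted in all the computations below. *)
Let U i := u i * q (t i).
Let W i := q (t i) * w i.

Let UW : \sum_i U i * W i = 1.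
Proof.
rewrite -[RHS]full; apply: eq_bigr => i _.
by rewrite /U /W mulrA -(mulrA (u i)) idem.
Qed.

Let Uq i : U i * q (t i) = U i.
Proof. by rewrite /U -mulrA idem. Qed.

(** If the [x i] generate [M], the elements [x_i U_j q_v] span [M q_v]: inserting the decomposition
    of 1 gives [x_i c_i q_v = \sum_j x_i U_j (W_j c_i q_v)], and each bracket is a scalar multiple
    of [q_v]. *)
Lemma finitely_generated_corner_dim (M : rmodType R) v :
  finitely_generated M -> exists d, corner_dim (q v) M d.
Proof.
move=> [m [x xM]].
pose b i j : restr_scalars M := ract (x i) (U j * q v).
have ls : linear (fun c : 'rV[K]_(m * n) =>
    \sum_i \sum_j vec_mx c i j *: b i j).
  move=> k c d; rewrite scaler_sumr -big_split; apply: eq_bigr => i _ /=.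
  rewrite scaler_sumr -big_split; apply: eq_bigr => j _ /=.
  by rewrite linearP !mxE scalerDl scalerA.
apply: (row_section (p := linear_pack (ract_linear (M := M) (q v)))
                    (s := linear_pack ls)) => [c|y] /=.
  rewrite ract_suml; apply: eq_bigr => i _.
  rewrite ract_suml; apply: eq_bigr => j _.
  by rewrite ractZl /b -ractM -mulrA idem.
have [c ->] := xM y.
have /choice[l lP] : forall k : 'I_m * 'I_n, exists l : K,
    W k.2 * (c k.1 : R) * q v = l *: q v.
  move=> [i j] /=; have [l] := corner (t j) v (w j * c i).
  rewrite !mulrA => ->; case: eqP => [->|_]; first by exists l; rewrite mulr1n.
  by exists 0; rewrite mulr0n scale0r.
exists (mxvec (\matrix_(i, j) l (i, j))); rewrite mxvecK ract_suml.
apply: eq_bigr => i _; rewrite -[c i *: x i]/(ract (x i) (c i)) -ractM.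
rewrite -[X in ract _ X]mul1r -UW mulr_suml ract_sumr.
apply: eq_bigr => j _.
by rewrite mxE /b -ractZr scalerAr -(lP (i, j)) !mulrA.
Qed.

Section Transfer.
Variables (M N : rmodType R).
Variable f : V -> {linear restr_scalars M -> restr_scalars N}.
Hypothesis fq : forall v x, ract (f v x) (q v) = f v x.

(* Since [x = \sum_i x U_i W_i], this is the only linear map that can extend the
   maps [f v : M q_v -> N q_v]. *)
Definition corner_glue (x : M) : N :=
  \sum_i ract (f (t i) (ract x (U i))) (W i).

(** The factor [W i * a * U j] lies between [q (t i)] and [q (t j)]: it is zero if these differ, and
    otherwise a scalar multiple of the idempotent, which [K]-linearity moves through [f]. *)
Lemma corner_transfer x i j a : f (t j) (ract x (U i * W i * a * U j)) =
  ract (f (t i) (ract x (U i))) (W i * a * U j).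
Proof.
have [k ck] := corner (t i) (t j) (w i * a * u j).
have -> : U i * W i * a * U j = U i * (k *: q (t i) *+ (t i == t j)).
  by rewrite -ck /U /W !mulrA.
have -> : W i * a * U j = k *: q (t i) *+ (t i == t j).
  by rewrite -ck /U /W !mulrA.
case: eqP => [<-|_]; last by rewrite !mulr0n mulr0 !ract0 linear0.
by rewrite !mulr1n -scalerAr Uq !ractZr linearZ fq.
Qed.

Lemma corner_glue_linear : linear corner_glue.
Proof.
move=> b x y; pose a : R := b.
rewrite -[b *: x]/(ract x a) -[b *: corner_glue x]/(ract (corner_glue x) a).
rewrite /corner_glue.
rewrite [X in _ = X + _](_ : _ =
    \sum_i ract (f (t i) (ract (ract x a) (U i))) (W i)).
  rewrite -big_split; apply: eq_bigr => i _.
  by rewrite ractDl linearD ractDl.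
(* Summing [F] over [i] first gives the glued map at [x a]; summing over [j] first gives its value
   at [x], times [a]. *)
pose F i j := ract (f (t j) (ract x (U i * W i * a * U j))) (W j).
transitivity (\sum_i \sum_j F i j); last first.
  rewrite exchange_big; apply: eq_bigr => j _ /=.
  rewrite -ract_suml -linear_sum -ract_sumr -!mulr_suml UW mul1r.
  by rewrite ractM.
rewrite ract_suml; apply: eq_bigr => i _.
rewrite -[in LHS]ractM -[a in LHS]mulr1 -UW 2!mulr_sumr ract_sumr.
by apply: eq_bigr => j _; rewrite /F corner_transfer -ractM !mulrA.
Qed.

End Transfer.

Lemma corner_glueK (M N : rmodType R)
    (f : V -> {linear restr_scalars M -> restr_scalars N})
    (g : V -> {linear restr_scalars N -> restr_scalars M}) :
  (forall v x, ract (f v x) (q v) = f v x) ->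
  (forall v x, g v (f v x) = ract x (q v)) ->
  cancel (corner_glue f) (corner_glue g).
Proof.
move=> fq gf x; rewrite {1}/corner_glue.
(* By [corner_transfer], the composite produces [g (f (x U_i W_i U_j)) W_j]; there [g] after [f] is
   multiplication by [q (t j)], which [U j] absorbs. The terms [F i j] add up to [x]. *)
pose F i j := ract x (U i * (W i * U j * W j)).
transitivity (\sum_j \sum_i F i j); last first.
  rewrite exchange_big -[RHS]ract1 -UW ract_sumr; apply: eq_bigr => i _ /=.
  rewrite -ract_sumr -mulr_sumr; under eq_bigr do rewrite -mulrA.
  by rewrite -mulr_sumr UW mulr1.
apply: eq_bigr => j _; rewrite /corner_glue ract_suml linear_sum ract_suml.
apply: eq_bigr => i _.
have := corner_transfer fq x i j 1; rewrite !mulr1 -ractM => <-.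
by rewrite gf -!ractM /F (mulrA _ (q _)) -(mulrA _ (U j)) Uq !mulrA.
Qed.

Lemma full_corner_iso (M N : rmodType R) :
  (forall v, exists d, corner_dim (q v) M d /\ corner_dim (q v) N d) ->
  mod_iso M N.
Proof.
move=> dimP.
have /choice[fg fgP] : forall v, exists fg :
    {linear restr_scalars M -> restr_scalars N} *
    {linear restr_scalars N -> restr_scalars M},
    [/\ forall x, ract (fg.1 x) (q v) = fg.1 x,
        forall y, ract (fg.2 y) (q v) = fg.2 y,
        forall x, fg.2 (fg.1 x) = ract x (q v)
      & forall y, fg.1 (fg.2 y) = ract y (q v)].
  move=> v; have [d [[f [g [fg gf]]] [f' [g' [fg' gf']]]]] := dimP v.
  (* Both maps pass through the common coordinate space [K^d]. *)
  exists (f' \o g : {linear _ -> _}, f \o g' : {linear _ -> _}).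
  by split=> x /=; rewrite -?fg -?fg' ?gf ?gf'.
pose f v := (fg v).1; pose g v := (fg v).2.
have fq v x : ract (f v x) (q v) = f v x by case: (fgP v).
have gq v x : ract (g v x) (q v) = g v x by case: (fgP v).
apply: (mod_iso_can (f := corner_glue f) (g := corner_glue g)).
- exact: corner_glue_linear.
- by apply: corner_glueK => // v x; case: (fgP v).
- by apply: corner_glueK => // v x; case: (fgP v).
Qed.

Lemma full_corner_cancellation : cancellation_of_projectives R.
Proof.
move=> M N fM _ fN _ iso; apply: full_corner_iso => v.
have fR : finitely_generated (R^c)^o.
  by exists 1%N, (fun=> 1) => p; exists (fun=> p); rewrite big_ord1 [RHS]mulr1.
have [m dM] := finitely_generated_corner_dim v fM.
have [p dN] := finitely_generated_corner_dim v fN.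
have [r dR] := finitely_generated_corner_dim v fR.
(* Dimensions are natural numbers, so the contribution [r] of [R] can be subtracted. *)
have := corner_dim_iso iso (corner_dim_prod dM dR) (corner_dim_prod dN dR).
by move=> /eqP; rewrite eqn_add2r => /eqP mp; exists m; rewrite {2}mp.
Qed.

End FullCorner.

(** If [P] fails at [v], every vertex where it fails emits an edge to another such vertex. Choosing
    one edge [h w] for each [w] gives a self-map [next] of a finite set; its iterates from [v] run
    into a loop, and the chosen edges along that loop form a cycle. *)
Lemma acyclic_ind (E : finGraph) (P : vertex E -> Prop) : acyclic E ->
  (forall v, (forall e, source e = v -> P (range e)) -> P v) -> forall v, P v.
Proof.
move=> acyE indP v; apply: contra_notP acyE => nPv.
have badP w : ~ P w -> exists e, source e = w /\ ~ P (range e).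
  by move=> nPw; apply: contra_notP nPw => noe; apply: indP => e ew;
     apply: contra_notP noe => nPe; exists e.
have [e0 _] := badP v nPv.
have /choice[h hP] : forall w, exists e, ~ P w -> source e = w /\ ~ P (range e).
  move=> w; have [Pw|/badP[e eP]] := pselect (P w); first by exists e0.
  by exists e.
pose next w := range (h w).
have bad n : ~ P (iter n next v) by elim: n => //= n /hP[].
have /trajectP[j ltj ej] := looping_order next v.
pose y := iter j next v.
have bady n : ~ P (iter n next y) by rewrite /y -iterD.
(* The orbit of [v] returns to its [j]-th point [y] after [order next v] steps, so [y] recurs after
   the difference. The criterion wants this positive number as a successor, hence the
   predecessor. *)
have cyc : fcycle next (orbit next y).
  apply/(orbitPcycle 3 0); exists (order next v - j).-1.
  by rewrite prednK ?subn_gt0 // /y -iterD subnK 1?ltnW.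
have src : {in orbit next y, forall w, source (h w) = w}.
  by move=> w /trajectP[n _ ->]; case: (hP _ (bady n)).
exists (map h (orbit next y)); rewrite /graph_cycle /closed_path.
rewrite -size_eq0 size_map size_orbit -lt0n order_gt0 /=.
rewrite -map_comp map_id_in // orbit_uniq andbT cycle_map.
apply: sub_in_cycle (allss _) cyc => w z _ zo /eqP wz /=.
by rewrite src // -wz.
Qed.

(** * The idempotents [gap v] and the ideal they generate *)

Section CohnCorner.
Variables (E : finGraph) (K : fieldType).
Local Notation C := (cohn E K).
Local Notation vtx := (cohn_vertex K).
Local Notation edg := (cohn_edge K).
Local Notation gho := (cohn_ghost K).

(** This is [q_v]: it equals [v] at a sink, and at any other vertex it is the element that vanishes
    in the Leavitt path algebra. *)
Definition gap (v : vertex E) : C :=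
  vtx v - \sum_(e | source e == v) edg e * gho e.

Lemma vertex_edge v e : vtx v * edg e = edg e *+ (v == source e) :> C.
Proof. by rewrite -source_edge mulrA vertexM mulrnAl. Qed.

Lemma ghost_vertex e v : gho e * vtx v = gho e *+ (source e == v) :> C.
Proof.
rewrite -ghost_source -mulrA vertexM; case: eqP => [<-|_] //.
by rewrite !mulr0n mulr0.
Qed.

Lemma gap_vertex v w : gap v * vtx w = gap v *+ (v == w).
Proof.
rewrite mulrBl vertexM mulr_suml mulrnBl.
congr (_ - _); first by case: eqP => [->|].
rewrite -sumrMnl; apply: eq_bigr => e /eqP <-.
by rewrite -mulrA ghost_vertex mulrnAr.
Qed.

(** If [s(e) = v], the summand [e e^* e = e] cancels [v e = e]; otherwise all terms vanish. *)
Lemma gap_edge v e : gap v * edg e = 0.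
Proof.
rewrite mulrBl vertex_edge mulr_suml.
have E1 f : edg f * gho f * edg e = edg e *+ (f == e) :> C.
  rewrite -mulrA ghost_edge; case: eqP => [->|]; first by rewrite edge_range.
  by rewrite mulr0n mulr0.
under eq_bigr do rewrite E1.
have [->|ne] := eqVneq v (source e).
  rewrite (bigD1 e) //= eqxx big1 ?addr0 ?subrr // => f /andP[_ /negbTE ->].
  by rewrite mulr0n.
rewrite big1 ?subrr // => f /eqP fv; case: eqP => // fe.
by rewrite -fv fe eqxx in ne.
Qed.

Lemma ghost_gap e v : gho e * gap v = 0.
Proof.
rewrite mulrBr ghost_vertex mulr_sumr.
have E1 f : gho e * (edg f * gho f) = gho e *+ (e == f) :> C.
  rewrite mulrA ghost_edge; case: eqP => [->|]; first by rewrite range_ghost.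
  by rewrite mulr0n mul0r.
under eq_bigr do rewrite E1.
have [<-|ne] := eqVneq (source e) v.
  rewrite (bigD1 e) //= eqxx big1 ?addr0 ?subrr // => f /andP[_].
  by rewrite eq_sym => /negbTE ->.
rewrite big1 ?subrr // => f /eqP fv; case: eqP => // fe.
by rewrite fe fv eqxx in ne.
Qed.

Lemma gapM v w : gap v * gap w = gap v *+ (v == w).
Proof.
rewrite {2}/gap mulrBr gap_vertex mulr_sumr big1 ?subr0 // => e _.
by rewrite mulrA gap_edge mul0r.
Qed.

(* The span of the [gap v * p^*], [p] a path ending at [v]. *)
Inductive gap_row v : C -> Prop :=
| GapRowScale k : gap_row v (k *: gap v)
| GapRowAdd x y : gap_row v x -> gap_row v y -> gap_row v (x + y)
| GapRowGhost x e : gap_row v x -> gap_row v (x * gho e).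

Lemma gap_row0 v : gap_row v 0.
Proof. by rewrite -(scale0r (gap v)); constructor. Qed.

Lemma gap_rowMn v x (b : bool) : gap_row v x -> gap_row v (x *+ b).
Proof. by case: b => //= _; exact: gap_row0. Qed.

Lemma gap_rowZ v k x : gap_row v x -> gap_row v (k *: x).
Proof.
elim=> [l|y z _ IHy _ IHz|y e _ IHy].
- by rewrite scalerA; constructor.
- by rewrite scalerDr; constructor.
- by rewrite scalerAl; constructor.
Qed.

Lemma gap_rowM_vertex v x w : gap_row v x -> gap_row v (x * vtx w).
Proof.
elim=> [l|y z _ IHy _ IHz|y e ry _].
- by rewrite -scalerAl gap_vertex -scalerMnr; apply: gap_rowMn; constructor.
- by rewrite mulrDl; constructor.
- by rewrite -mulrA ghost_vertex mulrnAr; apply: gap_rowMn; constructor.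
Qed.

Lemma gap_rowM_edge v x e : gap_row v x -> gap_row v (x * edg e).
Proof.
elim=> [l|y z _ IHy _ IHz|y f ry _].
- by rewrite -scalerAl gap_edge scaler0; exact: gap_row0.
- by rewrite mulrDl; constructor.
- rewrite -mulrA ghost_edge mulrnAr; exact/gap_rowMn/gap_rowM_vertex.
Qed.

(** Stability under the generators passes to all of [C] by induction on a term representing [a]. The
    span is therefore the right ideal [gap v * C]. *)
Lemma gap_rowM v x a : gap_row v x -> gap_row v (x * a).
Proof.
move: a x; elim/cohnW.
elim=> [w|e|e||y IHy z IHz|y IHy|k y IHy|y IHy z IHz] x rx.
- exact: gap_rowM_vertex.
- exact: gap_rowM_edge.
- exact: GapRowGhost.
- by rewrite mulr0; exact: gap_row0.
- by rewrite -cohn_addE mulrDr; constructor; [exact: IHy|exact: IHz].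
- by rewrite -cohn_oppE mulrN -scaleN1r; apply/gap_rowZ/IHy.
- by rewrite -cohn_scaleE -scalerAr; apply/gap_rowZ/IHy.
- by rewrite -cohn_mulE mulrA; apply/IHz/IHy.
Qed.

(** [gap w] kills every element ending in a ghost edge, so only the multiples of [gap v] survive. *)
Lemma gap_row_gap v w x : gap_row v x ->
  exists k : K, x * gap w = k *: gap v *+ (v == w).
Proof.
elim=> [k|y z _ [k yk] _ [l zl]|y e _ _].
- by exists k; rewrite -scalerAl gapM scalerMnr.
- by exists (k + l); rewrite mulrDl yk zl scalerDl mulrnDl.
- by exists 0; rewrite -mulrA ghost_gap mulr0 scale0r mul0rn.
Qed.

Lemma gap_corner v w a :
  exists k : K, gap v * a * gap w = k *: gap v *+ (v == w).
Proof. by apply/gap_row_gap/gap_rowM; rewrite -[gap v]scale1r; constructor. Qed.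

Definition gap_ideal (a : C) : Prop :=
  exists s : seq (C * vertex E * C), a = \sum_(i <- s) i.1.1 * gap i.1.2 * i.2.

Lemma gap_idealD a b : gap_ideal a -> gap_ideal b -> gap_ideal (a + b).
Proof. by move=> [s ->] [r ->]; exists (s ++ r); rewrite big_cat. Qed.

Lemma gap_idealM a b c : gap_ideal a -> gap_ideal (b * a * c).
Proof.
move=> [s ->]; exists [seq (b * i.1.1, i.1.2, i.2 * c) | i <- s].
by rewrite big_map mulr_sumr mulr_suml; apply: eq_bigr => i _; rewrite !mulrA.
Qed.

Lemma gap_ideal_sum I (r : seq I) (P : pred I) (F : I -> C) :
  (forall i, P i -> gap_ideal (F i)) -> gap_ideal (\sum_(i <- r | P i) F i).
Proof.
by apply: big_ind; [exists [::]; rewrite big_nil | exact: gap_idealD].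
Qed.

Lemma acyclic_gap_ideal1 : acyclic E -> gap_ideal 1.
Proof.
(* The unit of [C] is by definition the sum of the vertices. *)
move=> acyE; apply: gap_ideal_sum => v _.
apply: (acyclic_ind (P := fun v => gap_ideal (vtx v)) acyE) => {}v IHv.
rewrite -[cohn_vertex _ v](subrK (\sum_(e | source e == v) edg e * gho e)).
apply: gap_idealD; first by exists [:: (1, v, 1)]; rewrite big_seq1 mul1r mulr1.
apply: gap_ideal_sum => e /eqP /IHv re.
by rewrite -edge_range; exact: gap_idealM.
Qed.

Lemma acyclic_cancellation : acyclic E -> cancellation_of_projectives C.
Proof.
(* Indexing the list of triples by ordinals turns it into the families [u], [t], [w] of the
   hypothesis [full]. *)
move=> /acyclic_gap_ideal1[s]; rewrite big_tnth => full.
apply: (full_corner_cancellation gap_corner _ (esym full)) => v.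
by rewrite gapM eqxx.
Qed.

End CohnCorner.

Theorem corollary4p5 (E : finGraph) (K : fieldType) :
  [<-> cancellation_of_projectives (cohn E K);
       hermite (cohn E K);
       stably_finite (cohn E K);
       directly_finite (cohn E K);
       acyclic E].
Proof.
tfae.
- exact: cancellation_hermite.
- exact: hermite_stably_finite.
- exact: stably_finite_directly_finite.
- exact: directly_finite_acyclic.
- exact: acyclic_cancellation.
Qed.
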